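(* The characteristic polynomials of the intersection matrices of the following bouquets are: $\det(tI_n-A(\mathbb{F}'_n))=t\,\ell_{n-1}(t)$ for $n\geq2$; $\det(tI_n-A(\mathbb{F}'^{1}_n))=t\,\ell_{n-1}(t)-f_n(t)$ for $n\geq2$; $\det(tI_n-A(\mathbb{F}^{1}_n))=f_{n+1}(t)-f_n(t)$ for $n\geq1$; $\det(tI_n-A(\mathbb{W}^{1}_n))=(t-1)f_n(t)+2f_{n-1}(t)+(-1)^{n+1}-1$ for $n\geq3$; $\det(tI_n-A(\mathbb{F}'^{n}_n))=t\,(\ell_{n-1}(t)-\ell_{n-2}(t))$ for $n\geq3$.
   Context: A bouquet is a ribbon graph with one vertex; bouquets with edges $1,\dots,n$ are given by signed rotations: cyclic sequences in which each label occurs twice (order in which edge ends meet the vertex boundary), occurrences possibly carrying a minus sign; edge $i$ is an orientable loop iff both occurrences have the same sign. The bouquets: $\mathbb{F}'_2=(1,2,2,1)$ and, for $n\geq3$, $\mathbb{F}'_n=(1,2,3,2,1,4,3,5,4,\dots,n,n-1,n)$ (i.e. $1,2,3,2,1$, then $i,i-1$ for $i=4,\dots,n$, then $n$); $\mathbb{F}'^{1}_n$ is the same with the first occurrence of $1$ negated; $\mathbb{F}'^{n}_n$ ($n\geq3$) is the same as $\mathbb{F}'_n$ with the final occurrence of $n$ negated; $\mathbb{F}^{1}_n=(-1,2,1,3,2,4,3,\dots,n,n-1,n)$ (i.e. $-1$, then $i,i-1$ for $i=2,\dots,n$, then $n$); $\mathbb{W}^{1}_n=(-1,n,2,1,3,2,\dots,n,n-1)$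 (i.e. $-1,n$, then $i,i-1$ for $i=2,\dots,n$). Intersection matrix $A(B)$: on the boundary circle of the vertex each edge $i$ gives a chord joining its two ends, framed $1$ if the loop is non-orientable and $0$ otherwise; choose an ordering $(a_i,b_i)$ of each chord's endpoints; $A_{i,i}$ is the framing; for $i<j$, $A_{i,j}=1$ if the cyclic order is $a_i,a_j,b_i,b_j$, $-1$ if $a_i,b_j,b_i,a_j$, $0$ otherwise; $A_{j,i}=-A_{i,j}$. Fibonacci polynomials: $f_0(x)=0$, $f_1(x)=1$, $f_2(x)=x$, $f_{k+1}(x)=xf_k(x)+f_{k-1}(x)$; Lucas polynomials: $\ell_{k-1}(x)=f_k(x)+f_{k-2}(x)$. *)

(* Defs.v *)
From mathcomp Require Import all_boot all_order all_algebra.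
From mathcomp Require Import zify.

Set Implicit Arguments.
Unset Strict Implicit.
Unset Printing Implicit Defensive.

Import Order.TTheory GRing.Theory Num.Theory.
Local Open Scope ring_scope.

(* Signed rotations. The entry x stands for an end of the edge labelled `|x|,
   carrying the sign of x; labels run over 1, ..., n. The sequence is read
   cyclically: everything below depends on positions only through their cyclic
   order. *)
Definition signed_rotation (n : nat) (s : seq int) : bool :=
  perm_eq [seq `|x|%N | x <- s] (iota 1 n ++ iota 1 n).

Record bouquet (n : nat) := Bouquet {
  rotation : seq int;
  rotationP : signed_rotation n rotation }.

(* The edge labelled k is represented by the index i : 'I_n with i.+1 = k. *)
Definition orientable_loop n (B : bouquet n) (i : 'I_n) : bool :=
  constant [seq sgz x | x <- rotation B & `|x|%N == i.+1].

Definition framing n (B : bouquet n) (i : 'I_n) : int :=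
  if orientable_loop B i then 0 else 1.

(* Positions p, q, r, u on the boundary circle are distinct and are met in
   this cyclic order. *)
Definition cyclic_order (p q r u : nat) : bool :=
  has (fun k => sorted ltn (rot k [:: p; q; r; u])) (iota 0 4).

Definition is_end n (B : bouquet n) (i : 'I_n) (p : nat) : bool :=
  (p < size (rotation B))%N && (`|nth 0%R (rotation B) p|%N == i.+1).

(* A choice of an ordering (a_i, b_i) of the two ends of every chord. *)
Record end_ordering n (B : bouquet n) := EndOrdering {
  enda : 'I_n -> nat;
  endb : 'I_n -> nat;
  endaP : forall i, is_end B i (enda i);
  endbP : forall i, is_end B i (endb i);
  endab_neq : forall i, enda i != endb i }.

Definition crossing n (B : bouquet n) (o : end_ordering B) (i j : 'I_n) : int :=
  if cyclic_order (enda o i) (enda o j) (endb o i) (endb o j) then 1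
  else if cyclic_order (enda o i) (endb o j) (endb o i) (enda o j) then -1
  else 0.

Definition intersection_matrix n (B : bouquet n) (o : end_ordering B) :
    'M[int]_n :=
  \matrix_(i, j)
    if i == j then framing B i
    else if (i < j)%N then crossing o i j
    else - crossing o j i.

Lemma end_ordering_exists n (B : bouquet n) : inhabited (end_ordering B).
Proof.
set s := [seq `|x|%N | x <- rotation B].
have sB := rotationP B; rewrite /signed_rotation -/s in sB.
have cnt (i : 'I_n) : count_mem i.+1 s = 2.
  rewrite (permP sB) count_cat !count_uniq_mem ?iota_uniq // mem_iota.
  by rewrite add1n /= !ltnS ltn_ord.
pose a (i : 'I_n) := index i.+1 s.
pose b (i : 'I_n) := ((index i.+1 s).+1 + index i.+1 (drop (index i.+1 s).+1 s))%N.
have sa (i : 'I_n) : i.+1 \in s by rewrite -has_pred1 has_count cnt.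
have sb (i : 'I_n) : i.+1 \in drop (index i.+1 s).+1 s.
  have := cnt i; rewrite -{1}(cat_take_drop (index i.+1 s).+1 s) count_cat.
  rewrite (take_nth 0%N) ?index_mem ?sa // -cats1 count_cat nth_index ?sa //=.
  rewrite eqxx addn0 (_ : count _ (take _ _) = 0%N).
    by rewrite add0n add1n => -[h]; rewrite -has_pred1 has_count h.
  apply/eqP; rewrite -leqn0 leqNgt -has_count has_pred1; apply/negP => h.
  by have := index_ltn h; rewrite ltnn.
have szs : size s = size (rotation B) by rewrite size_map.
have isE (i : 'I_n) p : (p < size s)%N -> nth 0%N s p = i.+1 -> is_end B i p.
  move=> lt_p e; rewrite /is_end -szs lt_p /=.
  by rewrite -e (nth_map 0) // -szs.
have lt_b (i : 'I_n) : (b i < size s)%N.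
  by have := sb i; rewrite -index_mem size_drop ltn_subRL.
split; apply: (@EndOrdering _ _ a b) => i.
- by apply: isE; rewrite ?index_mem ?nth_index ?sa.
- by apply: isE; rewrite ?lt_b // /b -nth_drop nth_index ?sb.
- by rewrite /a /b addSn -addnS -[X in X != _]addn0 eqn_add2l.
Qed.

(* The word m, m-1, m+1, m, ..., n, n-1. *)
Definition staircase (m n : nat) : seq int :=
  flatten [seq [:: i%:Z; i%:Z - 1] | i <- index_iota m n.+1].

Definition negate_at (p : nat) (s : seq int) : seq int :=
  set_nth 0 s p (- nth 0 s p).

Definition Fprime_word (n : nat) : seq int :=
  if n == 2%N then [:: 1; 2; 2; 1]
  else [:: 1; 2; 3; 2; 1] ++ staircase 4 n ++ [:: n%:Z].
Definition Fprime1_word (n : nat) : seq int := negate_at 0 (Fprime_word n).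
Definition Fprimen_word (n : nat) : seq int :=
  negate_at (size (Fprime_word n)).-1 (Fprime_word n).
Definition F1_word (n : nat) : seq int := -1 :: staircase 2 n ++ [:: n%:Z].
Definition W1_word (n : nat) : seq int := [:: -1; n%:Z] ++ staircase 2 n.

Lemma perm_staircase m n : (0 < m <= n.+1)%N ->
  perm_eq [seq `|x|%N | x <- staircase m n]
          (iota m (n.+1 - m) ++ iota m.-1 (n.+1 - m)).
Proof.
move=> /andP[m0 mn]; rewrite /staircase /index_iota.
move: (n.+1 - m)%N => k; elim: k m m0 {mn} => [|k IH] m m0 //=.
have -> : `|m%:Z - 1|%N = m.-1 by lia.
rewrite perm_cons perm_sym -cat1s perm_catCA /= perm_cons perm_sym.
by have := IH m.+1 isT; rewrite prednK.
Qed.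

Lemma negate_at_rotation n s p : (p < size s)%N ->
  signed_rotation n s -> signed_rotation n (negate_at p s).
Proof.
move=> lt_p; rewrite /signed_rotation; congr (perm_eq _ _).
apply: (@eq_from_nth _ 0%N) => [|q].
  by rewrite !size_map size_set_nth (maxn_idPr lt_p).
rewrite size_map => lt_q.
have lt_q' : (q < size (negate_at p s))%N.
  by rewrite size_set_nth (maxn_idPr lt_p).
rewrite !(nth_map 0) // nth_set_nth /=.
by case: eqP => [->|//]; rewrite abszN.
Qed.

Lemma Fprime_rotation n : (2 <= n)%N -> signed_rotation n (Fprime_word n).
Proof.
rewrite /Fprime_word; case: eqP => [-> //|n2 le2n].
case: n n2 le2n => [|[|[|k]]] // _ _.
have := @perm_staircase 4 k.+3 isT.
rewrite (_ : k.+4 - 4 = k)%N; last lia.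
move=> /permP cS; apply/permP => P; have {}cS := cS P.
rewrite !map_cat !count_cat cS /= !count_cat.
have : (count P (iota 3 k) + P k.+3 = P 3 + count P (iota 4 k))%N.
  have := congr1 (count P) (iotaD 3 k 1).
  by rewrite addn1 count_cat /= addn0 => ->.
by rewrite ?absz_nat /= -[(1 + (1 + 1))%N]/3%N -[(1 + 1)%N]/2%N; lia.
Qed.

Lemma Fprime1_rotation n : (2 <= n)%N -> signed_rotation n (Fprime1_word n).
Proof.
move=> n2; apply: negate_at_rotation; last exact: Fprime_rotation.
by rewrite /Fprime_word; case: ifP.
Qed.

Lemma Fprimen_rotation n : (3 <= n)%N -> signed_rotation n (Fprimen_word n).
Proof.
move=> n3; apply: negate_at_rotation; last by apply: Fprime_rotation; lia.
by rewrite /Fprime_word; case: ifP.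
Qed.

Lemma F1_rotation n : (1 <= n)%N -> signed_rotation n (F1_word n).
Proof.
case: n => // k _; have := @perm_staircase 2 k.+1 isT.
rewrite (_ : k.+2 - 2 = k)%N; last lia.
move=> /permP cS; apply/permP => P; have {}cS := cS P.
rewrite /F1_word /= map_cat !count_cat cS /= !count_cat.
have : (count P (iota 1 k) + P k.+1 = P 1 + count P (iota 2 k))%N.
  have := congr1 (count P) (iotaD 1 k 1).
  by rewrite addn1 count_cat /= addn0 => ->.
by rewrite ?absz_nat /=; lia.
Qed.

Lemma W1_rotation n : (3 <= n)%N -> signed_rotation n (W1_word n).
Proof.
move=> n3; have n1 : (1 <= n)%N by lia.
have := F1_rotation n1; rewrite /signed_rotation; apply: perm_trans.
by rewrite /F1_word /W1_word /= perm_cons map_cat perm_sym perm_catC.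
Qed.

Definition Fprime n (hn : (2 <= n)%N) := Bouquet (Fprime_rotation hn).
Definition Fprime1 n (hn : (2 <= n)%N) := Bouquet (Fprime1_rotation hn).
Definition Fprimen n (hn : (3 <= n)%N) := Bouquet (Fprimen_rotation hn).
Definition F1 n (hn : (1 <= n)%N) := Bouquet (F1_rotation hn).
Definition W1 n (hn : (3 <= n)%N) := Bouquet (W1_rotation hn).

Fixpoint fib_poly (k : nat) : {poly int} :=
  match k with
  | 0 => 0
  | k'.+1 => match k' with
             | 0 => 1
             | k''.+1 => 'X * fib_poly k' + fib_poly k''
             end
  end.

(* The value at 0 is the usual one, given by f_(-1) = 1. *)
Definition lucas_poly (k : nat) : {poly int} :=
  if k is k'.+1 then fib_poly k.+1 + fib_poly k' else 2.

(* Main.v *)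
(** Exchanging the two ends of a chord conjugates the intersection matrix by a
    diagonal sign matrix, so its characteristic polynomial can be computed from
    any convenient ordering of the ends. For a suitable one, A(B) is the framing
    plus the skew-adjacency matrix of an oriented graph: a path for F^1, a path
    with a fork at one end for F', F'^1 and F'^n, a directed cycle for W^1. For
    the first two, expanding along the last row and column gives the Fibonacci
    recursion. For the cycle, expanding at the corners leaves path determinants
    and two triangular ones, which contribute the constants (-1)^(n+1) and -1. *)

Require Import Defs.
From mathcomp Require Import all_boot all_order all_algebra.
From mathcomp Require Import zify ring.

Set Implicit Arguments.
Unset Strict Implicit.
Unset Printing Implicit Defensive.

Import GRing.Theory Num.Theory.
Local Open Scope ring_scope.

(** * Cofactor expansions of determinants with entries indexed by natural numbers *)

Section NatIndexedDeterminants.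
Variable R : comNzRingType.
Implicit Types m : nat -> nat -> R.

(** Entries indexed by [nat] let one function [m] serve for every size: leading minors only change
    [n], and other minors only reindex [m], without casts between ordinals. *)
Definition natdet m n : R := \det (\matrix_(i < n, j < n) m i j).

Lemma eq_natdet n m1 m2 :
  (forall i j, (i < n)%N -> (j < n)%N -> m1 i j = m2 i j) ->
  natdet m1 n = natdet m2 n.
Proof.
by move=> e; congr (\det _); apply/matrixP=> i j; rewrite !mxE e.
Qed.

Lemma natdet_tr m n : natdet (fun i j => m j i) n = natdet m n.
Proof.
rewrite /natdet -det_tr; congr (\det _).
by apply/matrixP=> i j; rewrite !mxE.
Qed.

Lemma natdet0 m : natdet m 0 = 1. Proof. exact: det_mx00. Qed.

Lemma natdet_last_row m n :
  natdet m n.+1 =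
  \sum_(k < n.+1)
    m n k * ((-1) ^+ (n + k) * natdet (fun i j => m i (bump k j)) n).
Proof.
rewrite /natdet (expand_det_row _ ord_max); apply: eq_bigr => k _.
rewrite mxE /cofactor; congr (_ * (_ * \det _)).
apply/matrixP=> i j; rewrite !mxE /= /bump.
by rewrite (leqNgt n i) ltn_ord.
Qed.

Lemma natdet_last_col m n :
  natdet m n.+1 =
  \sum_(k < n.+1)
    m k n * ((-1) ^+ (n + k) * natdet (fun i j => m (bump k i) j) n).
Proof.
rewrite -natdet_tr natdet_last_row; apply: eq_bigr => k _.
by rewrite -[in RHS]natdet_tr.
Qed.

Lemma natdet_lower_trig m n : (forall i j, (i < j < n)%N -> m i j = 0) ->
  natdet m n = \prod_(i < n) m i i.
Proof.
move=> m0; rewrite /natdet det_trig.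
  by apply: eq_bigr => i _; rewrite mxE.
by apply/is_trig_mxP => i j ij; rewrite mxE m0 // ij ltn_ord.
Qed.

(** In a cycle the last vertex is adjacent only to its predecessor and to vertex 0, so Laplace
    expansion of its row has three terms. *)
Lemma natdet_corner_row m n : (0 < n)%N ->
  (forall j, (0 < j < n)%N -> m n.+1 j = 0) ->
  natdet m n.+2 = m n.+1 n.+1 * natdet m n.+1
    - m n.+1 n * natdet (fun i j => m i (bump n j)) n.+1
    + m n.+1 0%N * ((-1) ^+ n.+1 * natdet (fun i j => m i j.+1) n.+1).
Proof.
case: n => // n _ m0; rewrite natdet_last_row 2!big_ord_recr big_ord_recl /=.
rewrite big1 ?addr0 => [|i _]; last first.
  by rewrite m0 ?mul0r //= /bump /=; have := ltn_ord i; lia.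
rewrite addn0 -[(-1) ^+ (n.+2 + n.+1)]signr_odd.
rewrite -[(-1) ^+ (n.+2 + n.+2)]signr_odd.
rewrite !oddD /= !negbK !addbN !addbb /= expr1 expr0 mul1r.
rewrite [X in _ + _ * X = _](@eq_natdet _ _ m) => [|i j _ jn]; last first.
  by congr m; rewrite /bump leqNgt jn.
by ring.
Qed.

Lemma natdet_corner_col m n : (0 < n)%N ->
  (forall i, (0 < i < n)%N -> m i n = 0) ->
  natdet m n.+1 = m n n * natdet m n
    + m 0%N n * ((-1) ^+ n * natdet (fun i j => m i.+1 j) n).
Proof.
case: n => // n _ m0; rewrite natdet_last_col big_ord_recr big_ord_recl /=.
rewrite big1 ?addr0 => [|i _]; last first.
  by rewrite m0 ?mul0r //= /bump /=; have := ltn_ord i; lia.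
rewrite addn0 -[(-1) ^+ (n.+1 + n.+1)]signr_odd oddD addbb expr0 mul1r addrC.
congr (_ * _ + _); apply: eq_natdet => i j ni _.
by congr m; rewrite /bump leqNgt ni.
Qed.

(** The continuant recurrence: a vertex adjacent only to its predecessor is split off by expanding
    its row, then its column. *)
Lemma natdet_step m n :
  (forall j, (j < n)%N -> m n.+1 j = 0) ->
  (forall i, (i < n)%N -> m i n.+1 = 0) ->
  natdet m n.+2 =
    m n.+1 n.+1 * natdet m n.+1 - m n n.+1 * m n.+1 n * natdet m n.
Proof.
move=> r0 c0; rewrite natdet_last_row 2!big_ord_recr /=.
rewrite big1 ?add0r => [|i _]; last by rewrite r0 ?mul0r.
rewrite -[(-1) ^+ (n.+1 + n)]signr_odd -[(-1) ^+ (n.+1 + n.+1)]signr_odd.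
rewrite !oddD /= addNb !addbb expr1 expr0 mul1r mulN1r mulrN addrC.
congr (_ * _ - _).
  by apply: eq_natdet => i j _ jn; rewrite /bump leqNgt jn.
(* With column [n] deleted, the last column of the minor is column [n.+1] of [m], where only the
   entry in row [n] survives. *)
rewrite natdet_last_col big_ord_recr /= big1 ?add0r => [|i _]; last first.
  by rewrite /bump leqnn c0 ?mul0r.
rewrite -signr_odd addnn odd_double mul1r /bump leqnn add1n.
rewrite mulrA [m n.+1 n * _]mulrC; congr (_ * _).
by apply: eq_natdet => i j ni nj; rewrite !(leqNgt n) ni nj.
Qed.

(* The matrix d - S, where S is the skew-adjacency matrix of the oriented
   graph u. *)
Definition skew_mx (d : nat -> R) (u : rel nat) (i j : nat) : R :=
  if i == j then d i else if u i j then -1 else if u j i then 1 else 0.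

Lemma natdet1 m : natdet m 1 = m 0%N 0%N.
Proof. by rewrite /natdet det_mx11 mxE. Qed.

Lemma natdet2 m :
  natdet m 2 = m 0%N 0%N * m 1%N 1%N - m 0%N 1%N * m 1%N 0%N.
Proof. by rewrite natdet_step // natdet1 natdet0 mulr1 mulrC. Qed.

Lemma natdet3 m : natdet m 3 =
    m 2%N 2%N * (m 0%N 0%N * m 1%N 1%N - m 0%N 1%N * m 1%N 0%N)
  - m 2%N 1%N * (m 0%N 0%N * m 1%N 2%N - m 0%N 2%N * m 1%N 0%N)
  + m 2%N 0%N * (m 0%N 1%N * m 1%N 2%N - m 0%N 2%N * m 1%N 1%N).
Proof.
rewrite natdet_corner_row //; last by case=> [|[]].
by rewrite !natdet2 /= sqrrN expr1n mul1r.
Qed.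

End NatIndexedDeterminants.

(** * Determinants of oriented paths, forks and cycles *)

Definition path_rel : rel nat := fun i j => j == i.+1.

Definition fork_rel : rel nat :=
  fun i j => (0 < i)%N && (j == i.+1) || (i == 0%N) && (j == 2).

Definition cycle_rel (n : nat) : rel nat :=
  fun i j => (j == i.+1) || (i == n.-1) && (j == 0%N).

Lemma nat_ind2 (P : nat -> Prop) :
  P 0%N -> P 1%N -> (forall n, P n -> P n.+1 -> P n.+2) -> forall n, P n.
Proof.
move=> P0 P1 PS n; suff [] : P n /\ P n.+1 by [].
by elim: n => // n [IH1 IH2]; split=> //; apply: PS.
Qed.

Lemma fib_polySS n : fib_poly n.+2 = 'X * fib_poly n.+1 + fib_poly n.
Proof. by []. Qed.

(** Skew symmetry makes the two off-diagonal entries -1 and 1, which turns the minus sign of the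
    continuant into the plus sign of the Fibonacci recurrence. *)
Lemma natdet_skew_step (d : nat -> {poly int}) u n :
  (forall j, (j < n)%N -> ~~ u j n.+1 && ~~ u n.+1 j) ->
  u n n.+1 -> ~~ u n.+1 n ->
  natdet (skew_mx d u) n.+2 =
    d n.+1 * natdet (skew_mx d u) n.+1 + natdet (skew_mx d u) n.
Proof.
move=> un0 un un'; rewrite natdet_step => [|j jn|j jn].
- rewrite /skew_mx eqxx (gtn_eqF (ltnSn n)) (ltn_eqF (ltnSn n)) un (negbTE un').
  by rewrite mulr1 mulN1r opprK.
- have /andP[/negbTE a /negbTE b] := un0 _ jn.
  by rewrite /skew_mx a b gtn_eqF //; lia.
- have /andP[/negbTE a /negbTE b] := un0 _ jn.
  by rewrite /skew_mx a b ltn_eqF //; lia.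
Qed.

(** The determinant is affine in the corner entry: [e] multiplies the determinant of the path left
    after removing vertex 0. The values 1 and 0 of [e] are the framed and unframed cases. *)
Lemma natdet_path (d : nat -> {poly int}) e n :
  d 0%N = 'X - e -> (forall i, (0 < i < n)%N -> d i = 'X) ->
  natdet (skew_mx d path_rel) n = fib_poly n.+1 - e * fib_poly n.
Proof.
move=> d0; elim/nat_ind2: n => [|| n IH1 IH2] dX.
- by rewrite natdet0 /=; ring.
- by rewrite natdet1 /skew_mx /= d0; ring.
rewrite natdet_skew_step /path_rel => [|j jn|//|]; try lia.
rewrite dX ?IH1 ?IH2 => [|i ?|i ?|]; try (apply: dX; lia); try lia.
by rewrite !fib_polySS; ring.
Qed.

Lemma lucas_polySS n :
  lucas_poly n.+3 = 'X * lucas_poly n.+2 + lucas_poly n.+1.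
Proof. by rewrite /lucas_poly !fib_polySS; ring. Qed.

(** The prongs 0 and 1 are both joined to 2. Removing prong 0 leaves an unframed path on [n.+1]
    vertices, whence the coefficient [fib_poly n.+2] of [e]. *)
Lemma natdet_fork (d : nat -> {poly int}) e n :
  d 0%N = 'X - e -> (forall i, (0 < i < n.+2)%N -> d i = 'X) ->
  natdet (skew_mx d fork_rel) n.+2 =
    'X * lucas_poly n.+1 - e * fib_poly n.+2.
Proof.
move=> d0; elim/nat_ind2: n => [|| n IH1 IH2] dX.
- by rewrite natdet2 /skew_mx /= d0 dX //; ring.
(* Size 3 is computed by hand: vertex 2 is adjacent to both 0 and 1, so the recurrence only starts
   with vertex 3. *)
- by rewrite natdet3 /skew_mx /= d0 !dX //; ring.
rewrite natdet_skew_step /fork_rel => [|j jn||]; try lia.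
rewrite dX ?IH1 ?IH2 => [|i ?|i ?|]; try (apply: dX; lia); try lia.
by rewrite lucas_polySS (fib_polySS n.+2); ring.
Qed.

Lemma natdet_cycle (d : nat -> {poly int}) n :
  d 0%N = 'X - 1 -> (forall i, (0 < i < n.+3)%N -> d i = 'X) ->
  natdet (skew_mx d (cycle_rel n.+3)) n.+3 =
    ('X - 1) * fib_poly n.+3 + 2 * fib_poly n.+2 + (-1) ^+ n.+4 - 1.
Proof.
move=> d0 dX; set m := skew_mx d _.
(* Without its last vertex, the cycle is a path. *)
have mP i j : (i < n.+2)%N -> (j < n.+2)%N -> m i j = skew_mx d path_rel i j.
  move=> ? ?; rewrite /m /skew_mx /cycle_rel /path_rel /=.
  by do !case: ifP => //; lia.
(* The clause for [n.+3] records the arc leaving the matrix range; the equation is stated for all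
   [j]. *)
have mlast j : m n.+2 j = if j == n.+2 then 'X else if j == 0%N then -1 else
   if j == n.+1 then 1 else if j == n.+3 then -1 else 0.
  rewrite /m /skew_mx /cycle_rel /path_rel /=.
  by do !case: ifP => //; try lia; move=> *; apply: dX; lia.
have mlast' i : m i n.+2 = if i == n.+2 then 'X else if i == 0%N then 1 else
   if i == n.+1 then -1 else if i == n.+3 then 1 else 0.
  rewrite /m /skew_mx /cycle_rel /path_rel /=.
  by do !case: ifP => //; try lia; move=> *; apply: dX; lia.
have m0n : m 0%N n.+2 = 1 by rewrite mlast'.
have mnn : m n.+1 n.+2 = -1 by rewrite mlast' ltn_eqF //= eqxx.
rewrite natdet_corner_row // => [|j ?]; last by rewrite mlast !ifF //; lia.
have -> : natdet m n.+2 = fib_poly n.+3 - fib_poly n.+2.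
  rewrite -[fib_poly n.+2]mul1r -(@natdet_path d 1) => [|//|i ?].
    exact: eq_natdet.
  by apply: dX; lia.
(* The last column has its nonzero entries in the first and last rows. The last one leaves a framed
   path; the first leaves an upper triangular minor with unit diagonal. *)
have -> : natdet (fun i j => m i (bump n.+1 j)) n.+2 =
    - (fib_poly n.+2 - fib_poly n.+1) + (-1) ^+ n.+1.
  rewrite natdet_corner_col // /bump => [|i ?]; last first.
    by rewrite leqnn mlast' !ifF //; lia.
  rewrite leqnn m0n mnn mulN1r mul1r; congr (- _ + _).
    rewrite -[fib_poly n.+1]mul1r -(@natdet_path d 1) => [|//|i ?]; last first.
      by apply: dX; lia.
    apply: eq_natdet => i j ? ?.
    by have -> : (n.+1 <= j)%N = false; [lia | rewrite mP //; lia].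
  rewrite -natdet_tr natdet_lower_trig => [|i j ?].
    rewrite big1 ?mulr1 // => i _.
    rewrite /m /skew_mx /cycle_rel /=.
    by have := ltn_ord i; do !case: ifP => //; lia.
  rewrite /m /skew_mx /cycle_rel /=.
  by do !case: ifP => //; lia.
(* Here the last entry of the last column leaves a lower triangular minor with diagonal -1. The
   first leaves the path on vertices 1 to [n.+1], which misses the framed vertex 0. *)
have -> : natdet (fun i j => m i j.+1) n.+2 =
    (-1) ^+ n.+2 + (-1) ^+ n.+1 * fib_poly n.+2.
  rewrite natdet_corner_col // => [|i ?]; last first.
    by rewrite mlast' !ifF //; lia.
  rewrite m0n mnn mul1r.
  rewrite natdet_lower_trig => [|i j ?]; last first.
    rewrite /m /skew_mx /cycle_rel /=.
    by do !case: ifP => //; lia.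
  rewrite (eq_bigr (fun=> -1)) => [|i _]; last first.
    rewrite /m /skew_mx /cycle_rel /=.
    by have := ltn_ord i; do !case: ifP => //; lia.
  rewrite prodr_const card_ord -exprS; congr (_ + _ * _).
  have -> : fib_poly n.+2 = fib_poly n.+2 - 0 * fib_poly n.+1 by ring.
  rewrite -(@natdet_path (fun=> 'X)) ?subr0 //.
  apply: eq_natdet => i j ? ?; rewrite /m /skew_mx /cycle_rel /path_rel /=.
  by do !case: ifP => //; try lia; move=> *; apply: dX; lia.
have -> : m n.+2 n.+2 = 'X by rewrite mlast eqxx.
have -> : m n.+2 n.+1 = 1 by rewrite mlast ltn_eqF //= eqxx.
have -> : m n.+2 0%N = -1 by rewrite mlast.
(* The term of column 0 contains products of two signs; this relation lets [ring] reduce them. *)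
have s2 : (-1) ^+ n * (-1) ^+ n = 1 :> {poly int}.
  by rewrite -exprMn mulrNN mulr1 expr1n.
rewrite (exprS _ n.+3) (exprS _ n.+2) !(exprS _ n.+1) !(exprS _ n).
move: s2; rewrite (fib_polySS n.+1) (fib_polySS n).
move: (fib_poly n.+1) (fib_poly n) ((-1) ^+ n) => a b s s2.
ring: s2.
Qed.

(** * Independence of the ordering of the chord ends *)

Lemma cyclic_order_rot p q r u : cyclic_order p q r u = cyclic_order q r u p.
Proof. by rewrite /cyclic_order /= /rot /=; lia. Qed.

Lemma cyclic_order_asym p q r u :
  cyclic_order p q r u -> cyclic_order p u r q = false.
Proof. by rewrite /cyclic_order /= /rot /=; lia. Qed.

(* Exchanging the two ends of chord i negates row i and column i, so the
   characteristic polynomial may be computed with any ordering p, q of the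
   ends; u records which pairs cross positively for that ordering. *)
Lemma char_poly_intersection_matrix n (B : bouquet n) (o : end_ordering B)
    (p q : nat -> nat) (u : rel nat) (fr : nat -> bool) :
  (forall (i : 'I_n) x, is_end B i x -> x = p i \/ x = q i) ->
  (forall i, (i < n)%N ->
     (sgz (nth 0 (rotation B) (p i)) != sgz (nth 0 (rotation B) (q i)))
     = fr i) ->
  (forall i j, (i < n)%N -> (j < n)%N -> i != j ->
     cyclic_order (p i) (p j) (q i) (q j) = u i j) ->
  char_poly (intersection_matrix o) =
    natdet (skew_mx (fun i => 'X - (fr i)%:R) u) n.
Proof.
move=> endE frE uE.
have ends (i : 'I_n) : enda o i = p i /\ endb o i = q i \/
                       enda o i = q i /\ endb o i = p i.
  have := endab_neq o i.
  by case: (endE _ _ (endaP o i)) (endE _ _ (endbP o i)) => -> [] ->;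
    rewrite ?eqxx; auto.
have pP (i : 'I_n) : is_end B i (p i).
  by case: (ends i) (endaP o i) (endbP o i) => -[-> ->].
have qP (i : 'I_n) : is_end B i (q i).
  by case: (ends i) (endaP o i) (endbP o i) => -[-> ->].
have frameE (i : 'I_n) : framing B i = (fr i)%:R.
  rewrite /framing -frE // /orientable_loop; set L := [seq _ | x <- _ & _].
  have memL x : is_end B i x -> sgz (nth 0 (rotation B) x) \in L.
    by case/andP=> xs xi; rewrite map_f // mem_filter xi mem_nth.
  suff -> : constant L =
      (sgz (nth 0 (rotation B) (p i)) == sgz (nth 0 (rotation B) (q i))).
    by case: eqP.
  (* [L] collects the signs found at the ends of [i], and by [endE] these ends are [p i] and [q i]
     only. *)
  apply/idP/eqP => [cL|pq].
    have {}cL x y : x \in L -> y \in L -> x = y.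
      case: (L) cL => //= a L' /allP cL.
      have {}cL z : z \in a :: L' -> z = a.
        by rewrite inE => /orP[/eqP //|/cL/eqP].
      by move=> /cL -> /cL ->.
    exact: cL (memL _ (pP i)) (memL _ (qP i)).
  have {pq}: all (pred1 (sgz (nth 0 (rotation B) (p i)))) L.
    apply/allP => _ /mapP[x /[!mem_filter]/andP[xi /(nthP 0)[k ks xE]] ->] /=.
    have /endE[] : is_end B i k by rewrite /is_end ks xE.
      by rewrite -xE => ->.
    by rewrite -xE pq => ->.
  by case: L {memL} => //= a L' /andP[/eqP -> ].
(* The sign is -1 exactly at the chords that [o] orders opposite to [p], [q]. *)
pose s (i : 'I_n) : {poly int} := (-1) ^+ (enda o i != p i).
pose S : 'M[{poly int}]_n := diag_mx (\row_i s i).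
rewrite /char_poly.
have -> : char_poly_mx (intersection_matrix o) =
    S *m (\matrix_(i, j) skew_mx (fun i => 'X - (fr i)%:R) u i j) *m S.
  apply/matrixP => i j; rewrite mul_mx_diag mul_diag_mx !mxE /skew_mx.
  have [<-|ij] := eqVneq i j.
    rewrite eqxx mulr1n frameE mulrC mulrA /s -expr2 sqrr_sign mul1r.
    by rewrite rmorph_nat.
  have {}ij : (i : nat) != j by [].
  have ji : (j : nat) != i by rewrite eq_sym.
  rewrite (negbTE ij) mulr0n sub0r -!uE // /crossing /s.
  (* Rotating the tests that begin with chord [j] shows that a positive crossing of [j] with [i] is
     a negative crossing of [i] with [j]. *)
  rewrite !(cyclic_order_rot (p j)) !(cyclic_order_rot (enda o j)).
  have pq (k : 'I_n) : (q k == p k) = false.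
    apply/negbTE; have := endab_neq o k.
    by case: (ends k) => -[-> ->] //; rewrite eq_sym.
  have := @cyclic_order_asym (p i) (p j) (q i) (q j).
  have half b d : cyclic_order (q i) b (p i) d = cyclic_order (p i) d (q i) b.
    by rewrite 2!cyclic_order_rot.
  case: (ends i) (ends j) => -[-> ->] [] -[-> ->];
    rewrite ?eqxx ?pq /= ?expr0 ?expr1; rewrite ?half;
    case: (cyclic_order (p i) (p j) (q i) (q j)) => [->//|_];
    try case: (cyclic_order (p i) (q j) (q i) (p j));
    case: ltnP => _; rewrite ?rmorphN ?rmorph1 ?rmorph0; ring.
rewrite !det_mulmx mulrAC -det_mulmx.
suff -> : S *m S = 1%:M by rewrite det1 mul1r.
rewrite /S mulmx_diag -diag_const_mx; congr diag_mx.
by apply/rowP => i; rewrite !mxE -expr2 sqrr_sign.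
Qed.

(** * Entries of the words, and crossings read from linear positions *)

Lemma size_staircase m n : size (staircase m n) = (n.+1 - m).*2.
Proof.
rewrite /staircase /index_iota; move: (n.+1 - m)%N => k.
by elim: k m => //= k IH m; rewrite IH.
Qed.

Lemma nth_staircase m n x : (x < (n.+1 - m).*2)%N ->
  nth 0 (staircase m n) x = (m + x./2)%:Z - (odd x)%:Z.
Proof.
rewrite /staircase /index_iota; move: (n.+1 - m)%N => k.
elim: k m x => // k IH m [|[|x]] /= xk; try lia.
by rewrite IH; lia.
Qed.

Lemma size_F1_word n : (0 < n)%N -> size (F1_word n) = n.*2.
Proof. by move=> n0; rewrite /= size_cat size_staircase /=; lia. Qed.

Lemma nth_F1_word n x : (0 < x < n.*2)%N -> nth 0 (F1_word n) x =
  if x == n.*2.-1 then n%:Z else (2 + x.-1./2)%:Z - (odd x.-1)%:Z.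
Proof.
case: x => // x xn; rewrite -[LHS]/(nth 0 (staircase 2 n ++ [:: n%:Z]) x).
rewrite nth_cat size_staircase -pred_Sn.
case: ltnP => h.
  rewrite nth_staircase //.
  case: eqP => // ?; lia.
case: eqP => ?; last by lia.
have -> : (x - (n.+1 - 2).*2 = 0)%N by lia.
by [].
Qed.

Lemma size_W1_word n : (0 < n)%N -> size (W1_word n) = n.*2.
Proof. by move=> n0; rewrite /= size_staircase /=; lia. Qed.

Lemma nth_W1_word n x : (x.+2 < n.*2)%N ->
  nth 0 (W1_word n) x.+2 = (2 + x./2)%:Z - (odd x)%:Z.
Proof. by move=> xn; rewrite /= nth_staircase //; lia. Qed.

Lemma size_Fprime_word n : (1 < n)%N -> size (Fprime_word n) = n.*2.
Proof.
rewrite /Fprime_word; case: eqP => [->//|] n2 n1.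
by rewrite /= size_cat size_staircase /=; lia.
Qed.

Lemma nth_Fprime_word n x : (2 < n)%N -> (4 < x < n.*2)%N ->
  nth 0 (Fprime_word n) x =
  if x == n.*2.-1 then n%:Z else (4 + (x - 5)./2)%:Z - (odd (x - 5))%:Z.
Proof.
move=> n2; rewrite /Fprime_word ifF; last lia.
case: x => [|[|[|[|[|x]]]]] // xn.
rewrite -[LHS]/(nth 0 (staircase 4 n ++ [:: n%:Z]) x) !subSS subn0.
rewrite nth_cat size_staircase; case: ltnP => h.
  by rewrite nth_staircase //; case: eqP => // ?; lia.
case: eqP => ?; last by lia.
by have -> : (x - (n.+1 - 4).*2 = 0)%N by lia.
Qed.

Lemma nth_negate_at k s x :
  nth 0 (negate_at k s) x = if x == k then - nth 0 s k else nth 0 s x.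
Proof. by rewrite nth_set_nth. Qed.

Lemma size_negate_at k s : (k < size s)%N -> size (negate_at k s) = size s.
Proof. by move=> ks; rewrite size_set_nth (maxn_idPr ks). Qed.

(** Once each chord lists its smaller end first, only the unrotated sequence can be increasing, so
    crossing becomes interlacing of intervals. *)
Lemma cyclic_order_lt p q r u : (p < r)%N -> (q < u)%N ->
  cyclic_order p q r u = [&& p < q, q < r & r < u]%N.
Proof. by rewrite /cyclic_order /= /rot /=; lia. Qed.

(** * The bouquets F^1 *)

Lemma nth_F1_word_gt0 n x : (0 < x < n.*2)%N -> (0 < nth 0 (F1_word n) x)%R.
Proof. by move=> xn; rewrite nth_F1_word //; case: eqP => ?; lia. Qed.

Lemma char_poly_F1 n (hn : (1 <= n)%N) (o : end_ordering (F1 hn)) :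
  char_poly (intersection_matrix o) = fib_poly (n + 1) - fib_poly n.
Proof.
(* For [i = 0] truncation gives [i.*2.-1 = 0], the position of the entry -1. The last label has its
   second end at the end of the word instead of in a next pair. *)
rewrite (@char_poly_intersection_matrix _ _ _ (fun i => i.*2.-1)
  (fun i => if i == n.-1 then n.*2.-1 else i.*2.+2) path_rel (pred1 0%N)).
- rewrite (@natdet_path _ 1) ?mul1r ?addn1 // => i i0.
  by rewrite /= gtn_eqF ?subr0 //; lia.
- move=> i x; rewrite /is_end size_F1_word // => /andP[xn /eqP].
  have [->|x0] := posnP x; first by rewrite /=; lia.
  rewrite nth_F1_word ?x0 //.
  by case: eqP => ?; case: eqP => ?; lia.
- move=> i ni; set q := (if _ then _ else _).
  have qn : (0 < q < n.*2)%N by rewrite /q; case: eqP => ?; lia.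
  rewrite (@gtr0_sgz _ (nth 0 _ q)) ?nth_F1_word_gt0 //.
  case: i {q qn} ni => // i ni.
  by rewrite gtr0_sgz ?eqxx ?nth_F1_word_gt0 //; lia.
- move=> i j ni nj ij; rewrite cyclic_order_lt.
  + by rewrite /path_rel; case: eqP => ?; case: eqP => ?; lia.
  + by case: eqP => ?; lia.
  + by case: eqP => ?; lia.
Qed.

(** * The bouquets F', F'^1 and F'^n *)

Lemma nth_Fprime_word_gt0 n x :
  (1 < n)%N -> (x < n.*2)%N -> (0 < nth 0 (Fprime_word n) x)%R.
Proof.
move=> n1 xn; have [n2|n2] := eqVneq n 2.
  by rewrite n2 in xn *; case: x xn => [|[|[|[|]]]].
have n3 : (2 < n)%N by lia.
have [x4|x4] := ltnP 4 x.
  by rewrite nth_Fprime_word ?x4 //; case: eqP => ?; lia.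
by rewrite /Fprime_word (negbTE n2); case: x x4 {xn} => [|[|[|[|[|]]]]].
Qed.

(** The block 1, 2, 3, 2, 1 fills positions 0 to 4; from position 5 on, the pair opened by the label
    of index [i] starts at [i.*2.-1]. *)
Definition Fprime_start (i : nat) : nat := if (i < 3)%N then i else i.*2.-1.

Definition Fprime_end (n i : nat) : nat :=
  if n == 2 then (3 - i)%N else if (i < 2)%N then (4 - i)%N else
  if i == n.-1 then n.*2.-1 else i.*2.+2.

Lemma Fprime_word_ends n i x : (1 < n)%N -> (x < n.*2)%N ->
  `|nth 0%R (Fprime_word n) x|%N = i.+1 ->
  x = Fprime_start i \/ x = Fprime_end n i.
Proof.
move=> n1 xn; rewrite /Fprime_start /Fprime_end.
have [n2|n2] := eqVneq n 2.
  by rewrite n2 in xn *; case: x xn => [|[|[|[|]]]] //= _ [<-]; auto.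
have n3 : (2 < n)%N by lia.
have [x4|x4] := ltnP 4 x.
  rewrite nth_Fprime_word ?x4 //.
  case: eqP => ?; case: ltnP => ?; case: ltnP => ?; try case: eqP => ?; lia.
rewrite /Fprime_word (negbTE n2).
case: x x4 {xn} => [|[|[|[|[|]]]]] //= _ [<-] /=; auto.
Qed.

Lemma Fprime_start_lt_end n i : (i < n)%N -> (1 < n)%N ->
  (Fprime_start i < Fprime_end n i < n.*2)%N.
Proof.
rewrite /Fprime_start /Fprime_end => ni n1.
by case: (ltnP i 3) => ?; case: (n =P 2) => ?; case: (ltnP i 2) => ?;
  case: (i =P n.-1) => ?; lia.
Qed.

(** The chords of labels 1 and 2 are nested, hence disjoint, and both cross that of label 3 when
    there is one; beyond it only consecutive chords interlace. *)
Lemma Fprime_crossing n i j :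
  (1 < n)%N -> (i < n)%N -> (j < n)%N -> i != j ->
  cyclic_order (Fprime_start i) (Fprime_start j) (Fprime_end n i)
    (Fprime_end n j) = fork_rel i j.
Proof.
move=> n1 ni nj ij; have := Fprime_start_lt_end ni n1.
have := Fprime_start_lt_end nj n1 => /andP[pqj _] /andP[pqi _].
rewrite cyclic_order_lt // /fork_rel {pqi pqj}.
case: (eqVneq n 2) => [n2|n2].
  by subst n; case: i j ni nj ij => [|[|]] // [|[|]].
rewrite /Fprime_start /Fprime_end (negbTE n2).
by case: (ltnP i 3) => ?; case: (ltnP j 3) => ?; case: (ltnP i 2) => ?;
  case: (ltnP j 2) => ?; case: (i =P n.-1) => ?; case: (j =P n.-1) => ?; lia.
Qed.

(** All entries of [Fprime_word] are positive, so one negation frames exactly the chord ending at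
    [k]. *)
Lemma Fprime_negate_framing n k i : (i < n)%N -> (1 < n)%N ->
  let s := negate_at k (Fprime_word n) in
  (sgz (nth 0 s (Fprime_start i)) != sgz (nth 0 s (Fprime_end n i))) =
  (Fprime_start i == k) || (Fprime_end n i == k).
Proof.
move=> ni n1 s; have /andP[pq qn] := Fprime_start_lt_end ni n1.
have sg x : (x < n.*2)%N -> sgz (nth 0 s x) = (-1) ^+ (x == k).
  move=> xn; rewrite nth_negate_at; case: eqP => [<-|_].
    by rewrite sgzN gtr0_sgz ?nth_Fprime_word_gt0.
  by rewrite gtr0_sgz ?nth_Fprime_word_gt0.
rewrite !sg //; last exact: ltn_trans pq qn.
by move: pq; case: (_ i =P k) => [->|_]; case: (_ n i =P k) => [->|_] //;
  rewrite ltnn.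
Qed.

Lemma char_poly_Fprime n (hn : (2 <= n)%N) (o : end_ordering (Fprime hn)) :
  char_poly (intersection_matrix o) = 'X * lucas_poly (n - 1).
Proof.
rewrite (@char_poly_intersection_matrix _ _ _ Fprime_start (Fprime_end n)
  fork_rel xpred0).
- case: n hn o => [|[|n]] // hn o.
  by rewrite (@natdet_fork _ 0) ?mul0r ?subr0 ?subn1 // => i _; rewrite subr0.
- move=> i x; rewrite /is_end size_Fprime_word // => /andP[xn /eqP].
  exact: Fprime_word_ends.
- move=> i ni; have /andP[pq qn] := Fprime_start_lt_end ni hn.
  by rewrite !gtr0_sgz ?nth_Fprime_word_gt0 ?eqxx //; apply: ltn_trans pq qn.
- by move=> i j; apply: Fprime_crossing.
Qed.

Lemma Fprime_negate_ends n k (B : bouquet n) (i : 'I_n) x :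
  rotation B = negate_at k (Fprime_word n) -> (k < n.*2)%N -> (1 < n)%N ->
  is_end B i x -> x = Fprime_start i \/ x = Fprime_end n i.
Proof.
move=> BE kn n1.
rewrite /is_end BE size_negate_at size_Fprime_word // => /andP[xn /eqP nx].
apply: Fprime_word_ends => //; rewrite -nx nth_negate_at.
by case: eqP => // ->; rewrite abszN.
Qed.

Lemma char_poly_Fprime1 n (hn : (2 <= n)%N) (o : end_ordering (Fprime1 hn)) :
  char_poly (intersection_matrix o) = 'X * lucas_poly (n - 1) - fib_poly n.
Proof.
rewrite (@char_poly_intersection_matrix _ _ _ Fprime_start (Fprime_end n)
  fork_rel (pred1 0%N)).
- case: n hn o => [|[|n]] // hn o.
  rewrite (@natdet_fork _ 1) ?mul1r ?subn1 // => i i0.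
  by rewrite /= gtn_eqF ?subr0 //; lia.
- by move=> i x; apply: (@Fprime_negate_ends _ 0) => //; lia.
- move=> i ni; rewrite Fprime_negate_framing //=.
  have /andP[pq _] := Fprime_start_lt_end ni hn.
  move: pq; by rewrite /Fprime_start; case: (ltnP i 3) => ?; lia.
- by move=> i j; apply: Fprime_crossing.
Qed.

(** The framed vertex is the tip of the tail: its framing subtracts the determinant of the unframed
    fork on the other [n - 1] vertices. *)
Lemma char_poly_Fprimen n (hn : (3 <= n)%N) (o : end_ordering (Fprimen hn)) :
  char_poly (intersection_matrix o) =
    'X * (lucas_poly (n - 1) - lucas_poly (n - 2)).
Proof.
have n1 := ltnW hn.
rewrite (@char_poly_intersection_matrix _ _ _ Fprime_start (Fprime_end n)
  fork_rel (pred1 n.-1)).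
- case: n hn n1 o => [|[|[|n]]] // _ _ _; rewrite !subSS !subn0 -pred_Sn.
  set d := fun i => _.
  have dX i : (i < n.+2)%N -> d i = 'X.
    by move=> ni; rewrite /d /= ltn_eqF ?subr0.
  have dn : d n.+2 = 'X - 1 by rewrite /d /= eqxx.
  have fork0 k : (k <= n)%N -> natdet (skew_mx d fork_rel) k.+2 =
      'X * lucas_poly k.+1.
    move=> kn; rewrite (@natdet_fork _ 0) ?mul0r ?subr0 ?dX // => i ?.
    by apply: dX; lia.
  (* With three edges the framed tip is the branching vertex itself, adjacent to both prongs, so
     this case is computed directly. *)
  case: n @d dX dn fork0 => [|n] d dX dn fork0.
    by rewrite natdet3 /skew_mx /= dn !dX //=; ring.
  rewrite natdet_skew_step /fork_rel => [|j jn||]; try lia.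
  by rewrite dn !fork0 // (lucas_polySS n); ring.
- move=> i x; apply: (@Fprime_negate_ends _ (size (Fprime_word n)).-1) => //.
  by rewrite size_Fprime_word //; lia.
- move=> i ni; rewrite Fprime_negate_framing // size_Fprime_word //=.
  rewrite /Fprime_start /Fprime_end.
  by case: (ltnP i 3) => ?; case: (n =P 2) => ?; case: (ltnP i 2) => ?;
    case: (i =P n.-1) => ?; lia.
- by move=> i j; apply: Fprime_crossing.
Qed.

(** * The bouquets W^1 *)

Lemma nth_W1_word_gt0 n x : (0 < x < n.*2)%N -> (0 < nth 0 (W1_word n) x)%R.
Proof.
case: x => [|[|x]] // xn; last by rewrite nth_W1_word //; lia.
by rewrite /=; lia.
Qed.

Lemma char_poly_W1 n (hn : (3 <= n)%N) (o : end_ordering (W1 hn)) :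
  char_poly (intersection_matrix o) =
    ('X - 1) * fib_poly n + 2 * fib_poly (n - 1) + (-1) ^+ (n + 1) - 1.
Proof.
(* The chord of label n is oriented backwards, which makes the graph a
   directed cycle. *)
rewrite (@char_poly_intersection_matrix _ _ _ double
  (fun i => if i == n.-1 then 1%N else i.*2.+3) (cycle_rel n) (pred1 0%N)).
- case: n hn o => [|[|[|n]]] // _ _.
  rewrite natdet_cycle ?addn1 ?subn1 // => i i0.
  by rewrite /= gtn_eqF ?subr0 //; lia.
- move=> i x; rewrite /is_end size_W1_word => [/andP[xn /eqP]|]; last by lia.
  case: x xn => [|[|x]] xn; last rewrite nth_W1_word //; rewrite /=;
    case: eqP => ?; lia.
- move=> i ni; set q := (if _ then _ else _).
  have qn : (0 < q < n.*2)%N by rewrite /q; case: eqP => ?; lia.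
  rewrite (@gtr0_sgz _ (nth 0 _ q)) ?nth_W1_word_gt0 //.
  case: i {q qn} ni => // i ni.
  by rewrite gtr0_sgz ?eqxx ?nth_W1_word_gt0 //; lia.
- move=> i j ni nj ij; rewrite /cycle_rel.
  case: (i =P n.-1) => ?; case: (j =P n.-1) => ?; first by lia.
  (* The last chord runs from a larger position to position 1; rotating the test puts its smaller
     end first. *)
  + by rewrite cyclic_order_rot cyclic_order_lt; lia.
  + by rewrite 3!cyclic_order_rot cyclic_order_lt; lia.
  + by rewrite cyclic_order_lt; lia.
Qed.

Theorem theorem5p11 :
  (forall (n : nat) (hn : (2 <= n)%N) (o : end_ordering (Fprime hn)),
     char_poly (intersection_matrix o) = 'X * lucas_poly (n - 1)) /\
  (forall (n : nat) (hn : (2 <= n)%N) (o : end_ordering (Fprime1 hn)),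
     char_poly (intersection_matrix o) =
       'X * lucas_poly (n - 1) - fib_poly n) /\
  (forall (n : nat) (hn : (1 <= n)%N) (o : end_ordering (F1 hn)),
     char_poly (intersection_matrix o) = fib_poly (n + 1) - fib_poly n) /\
  (forall (n : nat) (hn : (3 <= n)%N) (o : end_ordering (W1 hn)),
     char_poly (intersection_matrix o) =
       ('X - 1) * fib_poly n + 2 * fib_poly (n - 1) + (-1) ^+ (n + 1) - 1) /\
  (forall (n : nat) (hn : (3 <= n)%N) (o : end_ordering (Fprimen hn)),
     char_poly (intersection_matrix o) =
       'X * (lucas_poly (n - 1) - lucas_poly (n - 2))).
Proof.
split; first exact: char_poly_Fprime.
split; first exact: char_poly_Fprime1.
split; first exact: char_poly_F1.
by split; [exact: char_poly_W1 | exact: char_poly_Fprimen].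
Qed.
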